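(* Let $b_0>0$ and let $\vec v=\{v_n\}_{n\ge 0}$ be a real sequence with $1=v_0\le v_1\le v_2\le\cdots$ satisfying, for all integers $n\ge 2$ and $p\ge 1$ with $2p\le n$, $$v_{n-2}v_{2p-1}+v_{2p-3}v_{n-2p}=v_nv_{2p-3}+v_{2p-1}v_{n-2p}$$ (with $v_{-1}:=0$), and such that $v_n>v_{n-2}$ for all $n\ge 2$. Suppose moreover that $$v_{2p+1}=(p+1)v_1\quad (p\ge 1),\qquad v_{2m}=m v_2-(m-1)\quad (m\ge 1).$$ Let $\{\psi_n(x)\}_{n\ge 0}$ be the orthonormal Hermite-Chihara polynomial system constructed from $\vec v$ and $b_0$ (defined in the context). Then for every $n\ge 0$ and every real $x\neq 0$, $$x\psi_n''(x)+\Bigl(\frac{3-v_2}{v_2-1}-\frac{2}{b_0^2(v_2-1)}x^2\Bigr)\psi_n'(x)+\Bigl(\frac{2}{b_0^2(v_2-1)}\,n\,x-\frac{\alpha_n}{x}\Bigr)\psi_n(x)=0,$$ where $$\alpha_n=\frac{3-v_2}{v_2-1}\cdot\frac{1-(-1)^n}{2}.$$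
   Context: Given $b_0>0$ and $\vec v$ as in the claim, define positive numbers $b_{n}$ by $$b_{n-1}^2=b_0^2\,\frac{v_{n-1}(v_n-v_{n-2})}{v_1},\qquad n\ge 2 .$$ The Hermite-Chihara polynomial system constructed from $\vec v$ and $b_0$ is the sequence of real polynomials $\{\psi_n\}_{n\ge0}$ determined by $$\psi_0(x)=1,\qquad \psi_1(x)=\frac{x}{b_0},\qquad x\psi_n(x)=b_n\psi_{n+1}(x)+b_{n-1}\psi_{n-1}(x)\quad(n\ge 1).$$ (These polynomials are orthonormal with respect to some symmetric probability measure on $\mathbb{R}$, namely a solution of the Hamburger moment problem for the Jacobi matrix with zero diagonal and off-diagonal entries $b_0,b_1,\dots$.) *)

(* Defs.v *)
From mathcomp Require Import all_boot all_order all_algebra.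
From mathcomp Require Import reals.

Set Implicit Arguments.
Unset Strict Implicit.
Unset Printing Implicit Defensive.

Import Order.TTheory GRing.Theory Num.Theory.
Local Open Scope ring_scope.

(* A sequence indexed by nat, extended by 0 to negative indices: this is how
   the convention v_{-1} = 0 enters the formulas. *)
Definition ext0 (R : realType) (v : nat -> R) (k : int) : R :=
  if k is Posz n then v n else 0.

Definition admissible (R : realType) (v : nat -> R) : Prop :=
  [/\ v 0%N = 1,
      forall n : nat, v n <= v n.+1,
      forall n p : nat, (2 <= n)%N -> (1 <= p)%N -> (2 * p <= n)%N ->
        ext0 v (n%:Z - 2) * ext0 v (2 * p%:Z - 1)
          + ext0 v (2 * p%:Z - 3) * ext0 v (n%:Z - 2 * p%:Z)
        = ext0 v n%:Z * ext0 v (2 * p%:Z - 3)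
          + ext0 v (2 * p%:Z - 1) * ext0 v (n%:Z - 2 * p%:Z)
    & forall n : nat, (2 <= n)%N -> v (n - 2)%N < v n].

Definition jacobi_coefficients (R : realType) (v : nat -> R) (b0 : R)
    (b : nat -> R) : Prop :=
  [/\ b 0%N = b0,
      forall n : nat, 0 < b n
    & forall n : nat, (2 <= n)%N ->
        b (n - 1)%N ^+ 2
        = b0 ^+ 2 * (v (n - 1)%N * (v n - v (n - 2)%N) / v 1%N)].

(* The data (b, psi) are uniquely determined by v and b0. *)
Definition hermite_chihara_system (R : realType) (v : nat -> R) (b0 : R)
    (psi : nat -> {poly R}) : Prop :=
  exists b : nat -> R,
  [/\ jacobi_coefficients v b0 b,
      psi 0%N = 1,
      psi 1%N = b0^-1 *: 'X
    & forall n : nat, (1 <= n)%N ->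
        'X * psi n = b n *: psi n.+1 + b (n - 1)%N *: psi (n - 1)%N].

(* Main.v *)
Require Import Defs.
From mathcomp Require Import all_boot all_order all_algebra.
From mathcomp Require Import reals.
From mathcomp Require Import ring.

Set Implicit Arguments.
Unset Strict Implicit.
Unset Printing Implicit Defensive.

Import Order.TTheory GRing.Theory Num.Theory.
Local Open Scope ring_scope.

(* With [k := 2 / (b0^2 (v_2 - 1))] and [g := (3 - v_2) / (v_2 - 1)], the
   hypotheses give [k b_n^2 = n + 1 + g [n even]]: up to scaling, these are the
   recurrence coefficients of the generalized Hermite polynomials, orthogonal for
   the weight [|x|^g exp (- k x^2 / 2)].  The Dunkl operator of parameter [g] is
   a lowering operator for them:
     x psi_n' + g [n odd] psi_n = k b_(n-1) x psi_(n-1),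
   and by the recurrence the right-hand side is also
   [k x (x psi_n - b_n psi_(n+1))].  Differentiating the first form for
   [psi_(n+1)] and eliminating [psi_n'] by the second form for [psi_n], then
   [psi_n] by the first one, yields the differential equation. *)

(** Reduces a goal to a ring identity once a combination [l = r] of known equations is supplied as a
    certificate. *)
Lemma linear_combination (A : pzRingType) (l r x y : A) :
  l = r -> x - y = l - r -> x = y.
Proof. by move=> -> /eqP; rewrite subrr subr_eq0 => /eqP. Qed.

Section GeneralizedHermite.

Variables (F : fieldType) (b : nat -> F) (psi : nat -> {poly F}) (g k : F).
Hypothesis b_neq0 : forall n, b n != 0.
Hypothesis b_sqr : forall n, k * b n ^+ 2 = n.+1%:R + g * (~~ odd n)%:R.
Hypothesis psi0 : psi 0%N = 1.
Hypothesis psi1 : b 0%N *: psi 1%N = 'X.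
Hypothesis psi_rec :
  forall n, 'X * psi n.+1 = b n.+1 *: psi n.+2 + b n *: psi n.

Lemma genhermite_lowering_raising n :
  'X * (psi n.+1)^`() + (g * (~~ odd n)%:R) *: psi n.+1
    = (k * b n) *: ('X * psi n) /\
  'X * (psi n)^`() + (g * (odd n)%:R) *: psi n
    = k *: ('X * ('X * psi n - b n *: psi n.+1)).
Proof.
elim: n => [|n [low rai]].
  split; last first.
    by rewrite psi0 psi1 derivC !mulr0 mulr1 subrr mulr0 scaler0 scale0r addr0.
  apply: (scalerI (b_neq0 0)); rewrite scalerDr scalerAr -derivZ psi1.
  rewrite scalerA (mulrC (b _)) -(scalerA (g * _)) psi1 derivX psi0 !mulr1 scalerA.
  have -> : b 0 * (k * b 0%N) = 1 + g.
    by rewrite mulrCA -expr2 b_sqr mulr1.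
  by rewrite scalerDl scale1r.
split; last first.
  by rewrite low psi_rec addrAC subrr add0r -scalerAr scalerA.
apply: (scalerI (b_neq0 n.+1)).
have oddN : (odd n)%:R = 1 - (~~ odd n)%:R :> F.
  by case: odd; rewrite ?subr0 ?subrr.
have /(congr1 polyC) s1 := b_sqr n.+1; have /(congr1 polyC) s0 := b_sqr n.
have rec := psi_rec n; have /(congr1 (@deriv F)) drec := rec.
move: low rai rec drec s0 s1; rewrite derivM derivX derivD !derivZ /= negbK oddN.
rewrite -!mul_polyC.
move=> low rai rec drec s0 s1.
(* [drec] gives $b_{n+1}\psi_{n+2}'$, [low] and [rai] remove the other derivatives, and the leftover
   multiple of $x\psi_{n+1}$ matches because
   $k(b_{n+1}^2-b_n^2)=1+g([n\text{ odd}]-[n\text{ even}])$. *)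
apply: (linear_combination
  (congr2 +%R (congr1 ( *%R 'X) low)
  (congr2 +%R (congr1 ( *%R (- (b n)%:P)) rai)
  (congr2 +%R (congr1 ( *%R (- 'X)) drec)
  (congr2 +%R (congr1 ( *%R (- (g%:P * (1%:P - (~~ odd n)%:R%:P)))) rec)
  (congr2 +%R (congr1 ( *%R ('X * psi n.+1)) s0)
              (congr1 ( *%R (- ('X * psi n.+1))) s1))))))).
ring.
Qed.

Lemma genhermite_ode n (x : F) : x != 0 ->
  x * (psi n)^`(2).[x] + (g - k * x ^+ 2) * (psi n)^`().[x]
  + (k * n%:R * x - g * (odd n)%:R / x) * (psi n).[x] = 0.
Proof.
case: n => [|n] x0.
  by rewrite psi0 derivnS derivn1 !derivC !hornerC /= !(mulr0, mul0r) subrr mul0r !addr0.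
have [low rai] := genhermite_lowering_raising n.
have /(congr1 (fun p => (p^`()).[x])) dlow := low.
move: low rai dlow => /(congr1 (horner^~ x)) + /(congr1 (horner^~ x)) +.
rewrite derivD !derivZ !derivM derivX derivnS derivn1.
rewrite !hornerE /=.
have s := b_sqr n.
(* The two eliminations multiply the parity terms of [rai] and [low]; the resulting $g^2e(1-e)$
   vanishes since $e$ is 0 or 1. *)
have odd_idem : (~~ odd n)%:R * (~~ odd n)%:R = (~~ odd n)%:R :> F.
  by case: odd; rewrite ?mulr0 ?mulr1.
have oddN : (odd n)%:R = 1 - (~~ odd n)%:R :> F.
  by case: odd; rewrite ?subr0 ?subrr.
rewrite oddN => low rai dlow; apply: (mulfI x0).
set y := (psi n.+1).[x] in low rai dlow *; set y0 := (psi n).[x] in low rai dlow.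
set e := (~~ odd n)%:R in low rai dlow s odd_idem *.
apply: (linear_combination
  (congr2 +%R (congr1 ( *%R x) dlow)
  (congr2 +%R (congr1 ( *%R (k * b n * x)) rai)
  (congr2 +%R (congr1 ( *%R (g * (1 - e) - k * x ^+ 2 - 1)) low)
  (congr2 +%R (congr1 ( *%R (- (k * x ^+ 2 * y))) s)
              (congr1 ( *%R (g ^+ 2 * y)) odd_idem)))))).
by field.
Qed.

End GeneralizedHermite.

Theorem mainTheorem2 (R : realType) (b0 : R) (v : nat -> R)
    (psi : nat -> {poly R})
    (b0_gt0 : 0 < b0)
    (v_adm : admissible v)
    (v_odd : forall p : nat, (1 <= p)%N -> v (2 * p + 1)%N = p.+1%:R * v 1%N)
    (v_even : forall m : nat, (1 <= m)%N ->
       v (2 * m)%N = m%:R * v 2%N - (m%:R - 1))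
    (psi_HC : hermite_chihara_system v b0 psi)
    (n : nat) (x : R) (x_neq0 : x != 0) :
  let alpha := (3 - v 2%N) / (v 2%N - 1) * ((1 - (-1) ^+ n) / 2) in
  x * (psi n)^`(2).[x]
  + ((3 - v 2%N) / (v 2%N - 1) - 2 / (b0 ^+ 2 * (v 2%N - 1)) * x ^+ 2)
    * (psi n)^`().[x]
  + (2 / (b0 ^+ 2 * (v 2%N - 1)) * n%:R * x - alpha / x) * (psi n).[x] = 0.
Proof.
have [v0 v_le _ v_lt] := v_adm.
case: psi_HC => b [[b_0 b_gt0 b_rec] psi0 psi1 psi_rec] alpha.
have w_neq0 : v 2%N - 1 != 0 by rewrite subr_eq0 gt_eqF // -v0 (v_lt 2).
have v1_neq0 : v 1%N != 0 by rewrite gt_eqF // (lt_le_trans ltr01) // -v0.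
have b0_neq0 : b0 != 0 by rewrite gt_eqF.
(* Both closed forms extend to index 0, which the case $b_1$ needs. *)
have vo p : v (2 * p).+1 = p.+1%:R * v 1%N.
  by case: p => [|p]; [rewrite mul1r | rewrite -addn1 v_odd].
have ve m : v (2 * m)%N = m%:R * v 2%N - (m%:R - 1).
  by case: m => [|m]; [rewrite mul0r sub0r opprB subr0 | rewrite v_even].
pose g := (3 - v 2%N) / (v 2%N - 1); pose k := 2 / (b0 ^+ 2 * (v 2%N - 1)).
have b_sqr i : k * b i ^+ 2 = i.+1%:R + g * (~~ odd i)%:R.
  case: i => [|i]; first by rewrite b_0 /k /g /=; field; apply/andP.
  have := b_rec i.+2 isT; rewrite !subSS !subn0 => ->.
  (* $b_{i+1}^2/b_0^2$ is $v_{2m+2}$ for $i=2m+1$, as consecutive odd terms differ by $v_1$, and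
     $(m+1)(v_2-1)$ for $i=2m$. *)
  rewrite -(odd_double_half i) -mul2n; set m := i./2.
  rewrite /= oddD mul2n odd_double addbF negbK -mul2n.
  have dS : (2 * m).+2 = (2 * m.+1)%N by rewrite mulnS.
  case: (odd i) => /=; rewrite ?add1n ?add0n dS.
    by rewrite !vo ve /k /g; field; rewrite w_neq0 b0_neq0 v1_neq0.
  by rewrite vo !ve /k; field; rewrite w_neq0 b0_neq0 v1_neq0.
have -> : alpha = g * (odd n)%:R.
  by rewrite /alpha /g -signr_odd; case: odd; rewrite /= ?expr1 ?expr0; field.
apply: (genhermite_ode (b := b)) => //.
- by move=> i; rewrite gt_eqF.
- by rewrite psi1 b_0 scalerA divff // scale1r.
- by move=> i; rewrite psi_rec // subn1.
Qed.
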